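(* Let $k \geq 1$ be an integer and let $G=(X,Y;E)$ be a bipartite graph with parts $X$ and $Y$ such that $\Delta(X) = 2$ and $\Delta(Y) = 2k$. Then $\chi'_{st}(G) \leq 3k$.
   Context: For a bipartite graph $G=(X,Y;E)$ with parts $X$, $Y$, $\Delta(X)$ and $\Delta(Y)$ denote the maximum degree of the vertices in $X$ and in $Y$, respectively. A star edge coloring of a graph is a proper edge coloring in which there is no path or cycle of length four (i.e., with four edges) whose edges use only two colors. The star chromatic index $\chi'_{st}(G)$ is the minimum number $t$ such that $G$ has a star edge coloring with $t$ colors. *)

(* Defs.v *)
From mathcomp Require Import all_boot.

Set Implicit Arguments.
Unset Strict Implicit.
Unset Printing Implicit Defensive.

Record sgraph := SGraph {
  vertex :> finType;
  adj : rel vertex;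
  adj_sym : symmetric adj;
  adj_irrefl : irreflexive adj
}.

Section SimpleGraph.
Variable G : sgraph.
Implicit Types (X Y : {set G}) (x : G).

Definition degree x : nat := #|[set y | adj x y]|.

Definition max_degree X : nat := \max_(x in X) degree x.

Definition bipartition X Y : Prop :=
  [/\ X :|: Y = [set: G], [disjoint X & Y]
    & forall x y, adj x y -> (x \in X) && (y \in Y) || (x \in Y) && (y \in X)].

Definition edge_set : {set {set G}} := [set [set x; y] | x in G, y in G & adj x y].

Definition edge : finType := {A : {set G} | A \in edge_set}.

(* The edges traversed by the walk whose successive vertices are x :: s. *)
Definition walk_edges x (s : seq G) : seq {set G} :=
  pairmap (fun u v => [set u; v]) x s.

Section Coloring.
Variables (t : nat) (c : {ffun edge -> 'I_t}).

Definition proper_edge_coloring : bool :=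
  [forall f : edge, forall g : edge,
    (f != g) && (val f :&: val g != set0) ==> (c f != c g)].

Definition colors_on (s : seq {set G}) : {set 'I_t} :=
  [set c f | f : edge & val f \in s].

(* A path with four edges has five distinct vertices x :: p; a cycle with four
   edges has four distinct vertices x :: p and is closed up by returning to x. *)
Definition star_edge_coloring : bool :=
  [&& proper_edge_coloring,
      [forall x : G, forall p : 4.-tuple G,
        path (@adj G) x p && uniq (x :: p) ==>
          (2 < #|colors_on (walk_edges x p)|)]
    & [forall x : G, forall p : 3.-tuple G,
        cycle (@adj G) (x :: p) && uniq (x :: p) ==>
          (2 < #|colors_on (walk_edges x (rcons p x))|)]].

End Coloring.

Definition star_edge_colorable (t : nat) : bool :=
  [exists c : {ffun edge -> 'I_t}, star_edge_coloring c].

Lemma adj_edge x y : adj x y -> [set x; y] \in edge_set.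
Proof. by move=> xy; apply/imset2P; exists x y; rewrite ?inE. Qed.

Lemma inj_colors_on t (c : {ffun edge -> 'I_t}) (s : seq {set G}) (x y z w : G) :
  injective c -> adj x y -> adj y z -> adj z w -> uniq [:: x; y; z; w] ->
  {subset [:: [set x; y]; [set y; z]; [set z; w]] <= s} -> 2 < #|colors_on c s|.
Proof.
move=> cI xy yz zw; rewrite /= !inE !negb_or -!andbA.
case/and5P=> nxy nxz nxw nyz /and3P[nyw nzw _] ss.
rewrite /colors_on card_imset //.
pose f1 : edge := exist (fun A => A \in edge_set) _ (adj_edge xy).
pose f2 : edge := exist (fun A => A \in edge_set) _ (adj_edge yz).
pose f3 : edge := exist (fun A => A \in edge_set) _ (adj_edge zw).
have D12 : f1 != f2.
  apply/eqP => /(congr1 val) /= /setP/(_ x).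
  by rewrite !inE eqxx (negbTE nxy) (negbTE nxz).
have D13 : f1 != f3.
  apply/eqP => /(congr1 val) /= /setP/(_ x).
  by rewrite !inE eqxx (negbTE nxw) (negbTE nxz).
have D23 : f2 != f3.
  apply/eqP => /(congr1 val) /= /setP/(_ y).
  by rewrite !inE eqxx (negbTE nyz) (negbTE nyw).
have <- : #|[set:: [:: f1; f2; f3]]| = 3.
  rewrite cardsE; apply/card_uniqP.
  by rewrite /= !inE negb_or D12 D13 D23.
apply/subset_leq_card/subsetP => f; rewrite !inE.
by case/or3P=> /eqP->; apply: ss; rewrite !inE eqxx ?orbT.
Qed.

Lemma star_edge_colorable_ex : exists t, star_edge_colorable t.
Proof.
exists #|edge|; apply/existsP.
pose c : {ffun edge -> 'I_#|edge|} := [ffun f => enum_rank f].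
have cI : injective c by move=> f g; rewrite !ffunE; apply: enum_rank_inj.
exists c; apply/and3P; split.
- apply/forallP => f; apply/forallP => g; apply/implyP => /andP[fg _].
  by rewrite (inj_eq cI).
- apply/forallP => x; apply/forallP => -[[|y [|z [|w [|v []]]]] //= sz].
  apply/implyP => /andP[/and5P[xy yz zw _ _] u].
  apply: (inj_colors_on cI xy yz zw).
    by move: u; rewrite -[_ && _]/(uniq ([:: x; y; z; w] ++ [:: v])) cat_uniq => /andP[].
  by move=> A; rewrite !inE => /or3P[]->; rewrite ?orbT.
- apply/forallP => x; apply/forallP => -[[|y [|z [|w []]]] //= sz].
  apply/implyP => /andP[/and5P[xy yz zw _ _] u].
  apply: (inj_colors_on cI xy yz zw) => // A.
  by rewrite !inE => /or3P[]->; rewrite ?orbT.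
Qed.

Definition star_chromatic_index : nat := ex_minn star_edge_colorable_ex.

End SimpleGraph.

(* Main.v *)
Require Import Defs.
From mathcomp Require Import all_boot.

Set Implicit Arguments.
Unset Strict Implicit.
Unset Printing Implicit Defensive.

(* Viewing the vertices of X as edges joining their two neighbours gives a
   multigraph on Y of maximum degree 2k. As in Petersen's 2-factor theorem it
   splits into k classes, each a disjoint union of directed paths and cycles:
   at every vertex of Y the incident edges get distinct slots (i, b), with i a
   class and b a direction, and the two edges at a vertex of X get opposite
   slots (i, b) and (i, ~~ b). Back in G, a two-coloured walk of length four
   traverses two edges at some vertex of X, so if each class has its own three
   colours, then the walk stays in one class. In a class, the vertices of X in
   cyclic order get colour pairs 01, 02, 01, 02, ..., with one final 12 on odd
   cycles, and no pattern abab arises. *)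

(** * Directed Petersen splitting by Kempe chains *)

Section Slotting.
Variables (A B S : finType) (e : A -> B -> bool) (sigma : S -> S).
Hypotheses (sigmaK : involutive sigma) (sigma_neq : forall a, sigma a != a).

(** Elements of [A] act as edges with ends in [B], and [sigma] pairs opposite slots. Only edges in
    [D] are constrained, so that edges can be inserted one at a time. *)
Definition slotting (D : {set A}) (phi : A -> B -> S) : Prop :=
  (forall x x' y, x \in D -> x' \in D -> e x y -> e x' y ->
     phi x y = phi x' y -> x = x') /\
  (forall x y y', x \in D -> e x y -> e x y' -> y != y' ->
     phi x y' = sigma (phi x y)).

Definition missing (D : {set A}) (phi : A -> B -> S) y a : Prop :=
  forall x, x \in D -> e x y -> phi x y != a.

(** The edge [x] has no slot yet, so the slotted edges at [y] are fewer than its degree. *)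
Lemma missing_exists (D : {set A}) phi x y :
  x \notin D -> e x y -> #|[set z | e z y]| <= #|S| -> exists a, missing D phi y a.
Proof.
move=> xD exy le_deg.
pose U := [set phi z y | z in [set z in D | e z y]].
have ltU : #|U| < #|S|.
  apply: leq_ltn_trans (leq_imset_card _ _) _; apply: leq_trans le_deg.
  apply: proper_card; apply/properP; split.
    by apply/subsetP => z; rewrite !inE => /andP[].
  by exists x; rewrite !inE ?(negbTE xD).
have [a aU] : exists a, a \notin U.
  apply/existsP; rewrite -negb_forall; apply: contraL ltU => /forallP allU.
  by rewrite -leqNgt; apply/subset_leq_card/subsetP.
exists a => z zD ezy; apply: contraNneq aU => <-.
by apply: imset_f; rewrite inE zD.
Qed.

(* The alternating chain through slots [s] and [t] is directed: it enters a
   vertex through [s] or [t] and leaves it through the image under [tau].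
   Hence swapping along the chain issued from [v] cannot create [s] at [u]. *)
Lemma kempe_swap (D : {set A}) phi u v s t :
  slotting D phi -> u != v -> missing D phi u s -> missing D phi v t ->
  exists phi', [/\ slotting D phi', missing D phi' u s
                 & missing D phi' v (sigma s)].
Proof.
move=> [inj_phi conj_phi] uv miss_s miss_t.
have [/existsP[x0 /and3P[x0D ex0v /eqP x0v]]|] :=
  boolP [exists x, [&& x \in D, e x v & phi x v == sigma s]]; last first.
  move/existsPn => no_x; exists phi; split=> // x xD exv.
  by have := no_x x; rewrite xD exv.
have ts : t != sigma s by rewrite eq_sym -x0v; apply: miss_t.
have sinj : injective sigma := inv_inj sigmaK.
(* [tau] exchanges [s] with [sigma t] and [t] with [sigma s]; the case [s = t] is allowed. It
   commutes with [sigma], so applying it at all ends of an edge keeps opposite slots opposite. *)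
pose inn a := (a == s) || (a == t).
pose tau a := if a == s then sigma t else if a == t then sigma s
  else if a == sigma s then t else if a == sigma t then s else a.
have st : s != sigma t by apply: contraNneq ts => ->; rewrite sigmaK.
have inn_sigma a : inn a -> ~~ inn (sigma a).
  case/orP=> /eqP->; rewrite negb_or sigma_neq ?andbT //= eq_sym //.
have tau_s : tau s = sigma t by rewrite /tau eqxx.
have tau_t : tau t = sigma s by rewrite /tau eqxx; case: eqP => // ->.
have tau_ss : tau (sigma s) = t.
  by rewrite /tau (negbTE (sigma_neq s)) eq_sym (negbTE ts) eqxx.
have tau_st : tau (sigma t) = s.
  rewrite /tau eq_sym (negbTE st) (negbTE (sigma_neq t)) eqxx (inj_eq sinj).
  by case: eqP.
have tau_id a : ~~ inn a -> ~~ inn (sigma a) -> tau a = a.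
  rewrite /tau !negb_or => /andP[/negbTE-> /negbTE->].
  by rewrite -!(can2_eq sigmaK sigmaK) => /andP[/negbTE-> /negbTE->].
have tauE a : [\/ a = s, a = t, a = sigma s | a = sigma t] \/
    ~~ inn a /\ ~~ inn (sigma a).
  rewrite /inn !negb_or !(can2_eq sigmaK sigmaK).
  have [->|_] := eqVneq a s; first by left; constructor 1.
  have [->|_] := eqVneq a t; first by left; constructor 2.
  have [->|_] := eqVneq a (sigma s); first by left; constructor 3.
  have [->|_] := eqVneq a (sigma t); first by left; constructor 4.
  by right.
have inn_s : inn s by rewrite /inn eqxx.
have inn_t : inn t by rewrite /inn eqxx orbT.
have tauK : involutive tau.
  move=> a; case: (tauE a) => [[] ->|[na nsa]].
  - by rewrite tau_s tau_st.
  - by rewrite tau_t tau_ss.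
  - by rewrite tau_ss tau_t.
  - by rewrite tau_st tau_s.
  - by rewrite !tau_id.
have tau_sigma a : tau (sigma a) = sigma (tau a).
  case: (tauE a) => [[] ->|[na nsa]].
  - by rewrite tau_s tau_ss sigmaK.
  - by rewrite tau_t tau_st sigmaK.
  - by rewrite tau_ss sigmaK tau_s.
  - by rewrite tau_st sigmaK tau_t.
  - by rewrite !tau_id ?sigmaK.
have inn_tau a : inn (sigma a) -> inn (tau a).
  case: (tauE a) => [[] ->|[_ /negbTE->]] //.
  - by rewrite (negbTE (inn_sigma _ inn_s)).
  - by rewrite (negbTE (inn_sigma _ inn_t)).
  - by rewrite tau_ss.
  - by rewrite tau_st.
pose next x x' := [exists y, [&& x' \in D, e x y, e x' y, inn (phi x y)
  & phi x' y == tau (phi x y)]].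
pose R := connect next x0.
have R_D x : R x -> x \in D.
  case/connectP=> p; case/lastP: p => [_ -> //|p z].
  by rewrite rcons_path last_rcons => /andP[_ /existsP[y /and5P[zD _ _ _ _]]] ->.
(* Backward closure: a chain edge leaving [y] is either the first one, leaving [v], or is preceded
   at [y] by another chain edge. *)
have R_pred x y : R x -> e x y -> inn (sigma (phi x y)) ->
    x = x0 /\ y = v \/ exists2 x', R x' & e x' y /\ phi x' y = tau (phi x y).
  move=> Rx exy out_xy; have xD := R_D x Rx; case/connectP: Rx => p.
  case/lastP: p => [_ /= xx0|p z].
    left; split=> //; subst x; apply: contraTeq out_xy => yv.
    by rewrite (conj_phi x0 v y) 1?eq_sym // x0v !sigmaK inn_sigma.
  rewrite rcons_path last_rcons => /andP[px0 /existsP[y']] /and5P[_ ez' ezy' i' /eqP phi_z] xz.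
  subst z; right; exists (last x0 p); first by apply/connectP; exists p.
  suff <- : y' = y by rewrite phi_z tauK.
  apply: contraTeq out_xy => yy'; rewrite (conj_phi x y' y) // sigmaK phi_z.
  by rewrite -[tau _]sigmaK -tau_sigma inn_sigma // inn_tau // sigmaK.
pose phi' x y := if R x then tau (phi x y) else phi x y.
(* Edges whose slots at [y] are exchanged by [tau] are swapped together or not at all, which keeps
   slots distinct. At the start of the chain the partner would occupy slot [t] at [v], which is
   missing. *)
have cross x x' y : R x -> x' \in D -> e x y -> e x' y ->
    tau (phi x y) = phi x' y -> R x'.
  move=> Rx x'D exy ex'y E; have xD := R_D x Rx.
  have [i_xy|n_xy] := boolP (inn (phi x y)).
    apply: connect_trans Rx _; apply/connect1/existsP; exists y.
    by rewrite x'D exy ex'y i_xy E /=.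
  have [o_xy|no_xy] := boolP (inn (sigma (phi x y))); last first.
    by rewrite -(inj_phi x x' y) // -E tau_id.
  have [[xx0 yv]|[x'' Rx'' [ex''y E'']]] := R_pred x y Rx exy o_xy.
    have := miss_t x' x'D; rewrite -yv ex'y -E xx0 yv x0v tau_ss eqxx.
    by move/(_ isT).
  by rewrite -(inj_phi x'' x' y) // ?R_D // E''.
exists phi'; split; [split| |].
- move=> x x' y xD x'D exy ex'y; rewrite /phi'.
  case: ifPn => Rx; case: ifPn => Rx' E.
  + by apply: (inj_phi _ _ y) => //; apply: (inv_inj tauK).
  + by rewrite (cross x x' y) in Rx'.
  + by rewrite (cross x' x y) in Rx.
  + exact: (inj_phi _ _ y).
- move=> x y y' xD exy exy' yy'; rewrite /phi' (conj_phi x y y') //.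
  by case: ifP; rewrite ?tau_sigma.
(* A chain edge moved into slot [s] at [u] came from [sigma t], so its predecessor held [s] at [u],
   which was missing. *)
- move=> x xD exu; rewrite /phi'; case: ifPn => [Rx|_]; last exact: miss_s.
  apply/eqP => /(congr1 tau); rewrite tauK tau_s => E.
  have := R_pred x u Rx exu; rewrite E sigmaK tau_st.
  case=> // [[_ /eqP]|[x' Rx' [ex'u /eqP]]]; first by rewrite (negbTE uv).
  by rewrite (negbTE (miss_s _ _ _)) ?R_D.
- move=> x xD exv; rewrite /phi'; case: ifPn => [Rx|nRx].
    apply/eqP => /(congr1 tau); rewrite tauK tau_ss => /eqP.
    by rewrite (negbTE (miss_t _ _ _)).
  apply: contra nRx => /eqP E; rewrite (inj_phi x x0 v) ?E //.
  exact: connect0.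
Qed.

(** Induction on the size of [D], inserting one edge [x]. Its two ends miss some slots [s] and [t],
    possibly unrelated; a Kempe swap makes [s] and [sigma s] available instead. An edge with a
    single end takes any missing slot. *)
Lemma slotting_exists (a0 : S) (D : {set A}) :
  (forall x, #|[set y | e x y]| <= 2) -> (forall y, #|[set x | e x y]| <= #|S|) ->
  exists phi, slotting D phi.
Proof.
move=> degA degB; have [n] := ubnP #|D|; elim: n D => // n IHn D ltn.
have [->|[x xD]] := set_0Vmem D.
  by exists (fun _ _ => a0); split=> [x x' y|x y y']; rewrite inE.
have [phi phiP] : exists phi, slotting (D :\ x) phi.
  by apply: IHn; move: ltn; rewrite (cardsD1 x) xD.
have xNx : x \notin D :\ x by rewrite !inE eqxx.
have missP y : e x y -> exists a, missing (D :\ x) phi y a.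
  by move=> exy; apply: missing_exists xNx exy (degB y).
suff [phi' [[inj' conj'] [f fmiss fconj]]] : exists phi', slotting (D :\ x) phi' /\
    exists2 f, forall y, e x y -> missing (D :\ x) phi' y (f y)
      & forall y y', e x y -> e x y' -> y != y' -> f y' = sigma (f y).
  exists (fun z y => if z == x then f y else phi' z y); split.
    move=> z z' y zD z'D ezy ez'y.
    case: (z =P x) ezy => [-> exy|/eqP zx ezy]; case: (z' =P x) ez'y => [-> // exy'|/eqP z'x ez'y].
    - move/eqP; rewrite eq_sym (negbTE (fmiss y exy z' _ ez'y)) // !inE z'x //.
    - move/eqP; rewrite (negbTE (fmiss y exy' z _ ezy)) // !inE zx //.
    - by apply: inj'; rewrite // !inE ?zx ?z'x.
  move=> z y y' zD /=; case: (z =P x) => [->|/eqP zx]; first exact: fconj.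
  by apply: conj'; rewrite !inE zx.
have [/existsP[u /existsP[v /and3P[exu exv uv]]]|] :=
  boolP [exists u, exists v, [&& e x u, e x v & u != v]].
  have [[s ms] [t mt]] := (missP u exu, missP v exv).
  have [phi' [phi'P ms' mt']] := kempe_swap phiP uv ms mt.
  have vu : (v == u) = false by rewrite eq_sym (negbTE uv).
  have nbr y : e x y -> y = u \/ y = v.
    move=> exy; have [yu|yu] := eqVneq y u; first by left.
    have [yv|yv] := eqVneq y v; first by right.
    have := degA x; rewrite leqNgt => /negP[].
    rewrite (cardsD1 u) (cardsD1 v) (cardsD1 y) !inE.
    by rewrite exu exv exy (eq_sym v) uv yu yv.
  exists phi'; split=> //; exists (fun y => if y == u then s else sigma s).
    by move=> y /nbr[]->; rewrite ?eqxx // vu.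
  by move=> y y' /nbr[]-> /nbr[]->; rewrite ?eqxx // vu ?sigmaK.
move=> /existsPn one; exists phi; split=> //.
have uniq_nbr y y' : e x y -> e x y' -> y = y'.
  move=> exy exy'; apply: contraNeq (one y) => yy'.
  by apply/existsP; exists y'; rewrite exy exy'.
have [/existsP[y exy]|/existsPn none] := boolP [exists y, e x y].
  have [a ma] := missP y exy; exists (fun _ => a) => [y' /(uniq_nbr _ _ exy)<- //|].
  by move=> z z' ez ez'; rewrite (uniq_nbr _ _ ez ez') eqxx.
by exists (fun _ => a0) => [y|y y']; rewrite (negbTE (none y)).
Qed.

End Slotting.

(** * Closing paths into cycles, and labels along cycles *)

(** The complements of domain and image have the same finite size, so they can be matched. This
    closes directed paths up, leaving only permutations to label. *)
Lemma partial_injection_extends (T : finType) (r : rel T) :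
  (forall x y y', r x y -> r x y' -> y = y') ->
  (forall x x' y, r x y -> r x' y -> x = x') ->
  exists2 f : T -> T, injective f & forall x y, r x y -> f x = y.
Proof.
move=> r_fun r_inj.
pose dom := [set x | [exists y, r x y]]; pose cod := [set y | [exists x, r x y]].
pose g x := odflt x [pick y | r x y].
have gE x y : r x y -> g x = y.
  by rewrite /g; case: pickP => [z rz ry|/(_ y)->] //; apply: r_fun rz ry.
have cod_g : cod = g @: dom.
  apply/setP => y; rewrite inE; apply/existsP/imsetP => [[x rxy]|[x]].
    by exists x; rewrite ?(gE x y) // inE; apply/existsP; exists y.
  by rewrite inE => /existsP[z rxz] ->; exists x; rewrite (gE x z).
have gI : {in dom &, injective g}.
  move=> x x'; rewrite !inE => /existsP[y rxy] /existsP[y' rxy'].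
  by rewrite (gE _ _ rxy) (gE _ _ rxy') => E; apply: r_inj rxy _; rewrite E.
have eq_cardC : #|~: dom| = #|~: cod|.
  by apply/eqP; rewrite -(eqn_add2l #|dom|) cardsC -(card_in_imset gI) -cod_g cardsC.
(* The complements are matched by rank in their enumerations; outside [dom] the default [x] is never
   reached. *)
pose h x := nth x (enum (~: cod)) (index x (enum (~: dom))).
have idx x : x \notin dom -> index x (enum (~: dom)) < size (enum (~: cod)).
  by move=> xd; rewrite -cardE -eq_cardC cardE index_mem mem_enum inE.
have h_cod x : x \notin dom -> h x \notin cod.
  by move=> /idx /(mem_nth x); rewrite mem_enum inE.
have g_cod x : x \in dom -> g x \in cod by move=> xd; rewrite cod_g imset_f.
exists (fun x => if x \in dom then g x else h x); last first.
  by move=> x y rxy; rewrite inE; case: existsP => [_|[]]; [apply: gE|exists y].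
move=> x x'; case: ifPn => xd; case: ifPn => x'd; first exact: gI.
- by move=> E; have := h_cod _ x'd; rewrite -E g_cod.
- by move=> E; have := h_cod _ xd; rewrite E g_cod.
rewrite /h (set_nth_default x' x) ?idx // => /eqP.
rewrite nth_uniq ?enum_uniq ?idx // => /eqP E.
by apply: (index_inj x _ _ E); rewrite mem_enum inE.
Qed.

(** The adjacent pairs in cyclic words 01...01 and 01...012: a 2 comes only after 1 and before 0. *)
Definition step (c c' : nat) : bool :=
  (c, c') \in [:: (0, 1); (1, 0); (1, 2); (2, 0)].

(* The value 2 is only used on the last point of an odd cycle. *)
Lemma step_labelling (T : finType) (f : T -> T) : injective f ->
  exists l : T -> nat, forall x, f x != x -> step (l x) (l (f x)).
Proof.
move=> fI; pose i x := findex f (froot f x) x; pose o x := order f (froot f x).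
exists (fun x => if odd (o x) && ((i x).+1 == o x) then 2 else odd (i x) : nat).
move=> x fx_x; have fsym := fconnect_sym fI.
have root_fx : froot f (f x) = froot f x.
  by apply/(rootP fsym); rewrite fsym fconnect1.
have conn : fconnect f (froot f x) x by rewrite fsym connect_root.
have iE : iter (i x) f (froot f x) = x by apply: iter_findex.
have lt_io : i x < o x by apply: findex_max.
have oE : o (f x) = o x by rewrite /o root_fx.
(* A cycle of length one would carry 2 followed by 2, which is not a step. *)
have o1 : o x != 1.
  apply: contra fx_x => /eqP E; move: (iter_order fI (froot f x)).
  rewrite -/(o x) E /= => fr.
  by move: lt_io iE; rewrite E; case: (i x) => //= _ <-; rewrite fr.
have iS : i (f x) = if (i x).+1 == o x then 0 else (i x).+1.
  rewrite {1}/i root_fx -{2}iE -iterS; case: eqP => [->|/eqP ne].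
    by rewrite (iter_order fI) findex0.
  by rewrite findex_iter // ltn_neqAle ne.
(* Wrapping around steps from 2 to 0 on odd cycles and from 1 to 0 on even ones; the last point of
   an odd cycle is entered from 1 to 2. *)
rewrite oE iS; case: eqP => [E|ne].
  rewrite -E /= in o1 *; case: (odd (i x)) => //=.
  by case: (i x) o1.
rewrite andbF /=; case: ifP => [/andP[odd_o /eqP E]|_]; last by case: odd.
by move: odd_o; rewrite -E /= negbK => ->.
Qed.

(** * A walk criterion for star edge colourings *)

(** Unless the pattern is abab, either [a], [b], [c] or [b], [c], [d] are three different
    colours. *)
Lemma card_gt2_alternating (C : finType) (U : {set C}) (a b c d : C) :
  {subset [:: a; b; c; d] <= U} -> a != b -> b != c -> c != d ->
  ~ (a = c /\ b = d) -> 2 < #|U|.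
Proof.
move=> sU ab bc cd nab.
have [aU bU cU dU] : [/\ a \in U, b \in U, c \in U & d \in U].
  by split; apply: sU; rewrite !inE eqxx ?orbT.
have [ac|ac] := eqVneq a c; last first.
  by rewrite (cardsD1 a) (cardsD1 b) (cardsD1 c) !inE aU bU cU eq_sym ab eq_sym bc eq_sym ac.
have bd : b != d by apply/eqP => bd; apply: nab.
by rewrite (cardsD1 b) (cardsD1 c) (cardsD1 d) !inE bU cU dU eq_sym bc eq_sym cd eq_sym bd.
Qed.

(** One kind of walk covers both forbidden configurations: vertices two apart differ, while [x] and
    [v] may coincide, as in a 4-cycle. Colours live on ordered pairs to avoid edges encoded as
    sets. *)
Lemma star_colorable_of_walks (G : sgraph) (C : finType) (g : G -> G -> C) :
  (forall x y, adj x y -> g x y = g y x) ->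
  (forall x y z, adj y x -> adj y z -> x != z -> g y x != g y z) ->
  (forall x y z w v, path (@adj G) x [:: y; z; w; v] ->
     x != z -> y != w -> z != v -> ~ (g x y = g z w /\ g y z = g w v)) ->
  star_edge_colorable G #|C|.
Proof.
move=> g_sym g_proper g_star.
have ex (f : edge G) :
    exists p : G * G, (val f == [set p.1; p.2]) && adj p.1 p.2.
  have /imset2P[x y _] := valP f; rewrite !inE => /andP[_ xy] E.
  by exists (x, y); rewrite /= E eqxx.
(* The order of the two ends is arbitrary; symmetry of [g] makes the colour independent of it. *)
pose ends f := xchoose (ex f).
pose c : {ffun edge G -> 'I_#|C|} :=
  [ffun f => enum_rank (g (ends f).1 (ends f).2)].
have cE (f : edge G) x y : adj x y -> val f = [set x; y] -> c f = enum_rank (g x y).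
  move=> xy fE; rewrite ffunE; have /andP[/eqP] := xchooseP (ex f).
  rewrite -/(ends f); case: (ends f) => a b /=; rewrite fE => E ab.
  have : a \in [set x; y] by rewrite E !inE eqxx.
  have : b \in [set x; y] by rewrite E !inE eqxx orbT.
  rewrite !inE => /orP[]/eqP bE /orP[]/eqP aE; subst a b => //.
  - by rewrite adj_irrefl in ab.
  - by rewrite g_sym.
  - by rewrite adj_irrefl in ab.
have at_end (f : edge G) z : z \in val f -> exists2 y, adj z y & val f = [set z; y].
  have [[a b] /andP[/eqP-> ab]] := ex f.
  rewrite !inE => /orP[]/eqP->; first by eexists; first exact: ab.
  by eexists; [rewrite adj_sym; exact: ab | rewrite setUC].
have col_in s x y : adj x y -> [set x; y] \in s -> enum_rank (g x y) \in colors_on c s.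
  move=> xy sP; pose f : edge G := exist (fun A => A \in edge_set G) _ (adj_edge xy).
  by apply/imsetP; exists f; [rewrite inE | rewrite (cE f x y)].
have walk s x y z w v : path (@adj G) x [:: y; z; w; v] ->
    x != z -> y != w -> z != v ->
    {subset walk_edges x [:: y; z; w; v] <= s} -> 2 < #|colors_on c s|.
  move=> walk xz yw zv ss; case/and5P: (walk) => xy yz zw wv _.
  pose r (u u' : G) := enum_rank (g u u').
  apply: (@card_gt2_alternating _ _ (r x y) (r y z) (r z w) (r w v)).
  - move=> i; rewrite !inE => /or4P[]/eqP->; apply: col_in => //; apply: ss;
      by rewrite !inE eqxx ?orbT.
  - by rewrite (inj_eq enum_rank_inj) g_sym ?g_proper // adj_sym.
  - by rewrite (inj_eq enum_rank_inj) g_sym ?g_proper // adj_sym.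
  - by rewrite (inj_eq enum_rank_inj) g_sym ?g_proper // adj_sym.
  - by case=> /enum_rank_inj e1 /enum_rank_inj e2; apply: (g_star x y z w v).
apply/existsP; exists c; apply/and3P; split.
- apply/forallP => f; apply/forallP => h; apply/implyP => /andP[fh /set0Pn[z]].
  rewrite inE => /andP[/at_end[y zy fE] /at_end[y' zy' hE]].
  rewrite (cE f z y) // (cE h z y') // (inj_eq enum_rank_inj) g_proper //.
  by apply: contraNneq fh => yy'; apply/eqP/val_inj; rewrite fE hE yy'.
- apply/forallP => x; apply/forallP => -[[|y [|z [|w [|v []]]]] //= sz].
  apply/implyP => /andP[xp]; rewrite !inE !negb_or -!andbA.
  case/and5P=> _ xz _ _ /and5P[_ yw _ _ /andP[zv _]].
  exact: (walk _ x y z w v).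
- apply/forallP => x; apply/forallP => -[[|y [|z [|w []]]] //= sz].
  apply/implyP => /andP[xp]; rewrite !inE !negb_or -!andbA.
  case/and5P=> _ xz _ _ /andP[yw _].
  by apply: (walk _ x y z w x) => //; rewrite eq_sym.
Qed.

(** * Three colours within one class *)

(* The labels 0, 1, 2 stand for the colour pairs 01, 02, 12. *)
Definition in_color (l : nat) : 'I_3 := if l == 2 then @Ordinal 3 1 isT else ord0.
Definition out_color (l : nat) : 'I_3 :=
  if l == 0 then @Ordinal 3 1 isT else @Ordinal 3 2 isT.

Lemma in_out_color l : in_color l != out_color l.
Proof. by case: l => [|[|[]]]. Qed.

(** The clauses serve, in order, properness at a vertex of [Y], walks starting in [Y], and walks
    starting in [X]. For the last, out colours agree only on the step from 1 to 2, and the next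
    step, from 2 to 0, changes the in colour. *)
Lemma stepP l l' : step l l' ->
  [/\ out_color l != in_color l',
      ~ (in_color l = in_color l' /\ out_color l = out_color l')
    & forall l'', step l' l'' ->
        ~ (out_color l = out_color l' /\ in_color l' = in_color l'')].
Proof.
have stepE c c' : step c c' -> [\/ (c, c') = (0, 1), (c, c') = (1, 0),
    (c, c') = (1, 2) | (c, c') = (2, 0)].
  by rewrite /step !inE => /or4P[]/eqP; [constructor 1 | constructor 2 | constructor 3 | constructor 4].
case/stepE=> -[-> ->]; split=> // [[]|l'' /stepE[][] // -> []] //.
Qed.

(** * Assembling the colouring of the bipartite graph *)

Theorem theorem7 (k : nat) (G : sgraph) (X Y : {set G})
  (k_ge1 : 1 <= k) (bipG : bipartition X Y)
  (degX : max_degree X = 2) (degY : max_degree Y = 2 * k) :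
  star_chromatic_index G <= 3 * k.
Proof.
have [XY dXY adjXY] := bipG.
have YX x : (x \in Y) = (x \notin X).
  have := in_setT x; rewrite -XY inE.
  by case: (boolP (x \in X)) => //= /(disjointFr dXY).
have adjX x y : adj x y -> (y \in X) = (x \notin X).
  by move/adjXY; rewrite !YX; case: (x \in X); case: (y \in X).
rewrite /star_chromatic_index; case: ex_minnP => m _; apply.
have -> : 3 * k = #|{: 'I_k * 'I_3}| by rewrite card_prod !card_ord mulnC.
(* Vertices outside [X] become edges without ends, so the slotting can range over all of [G]. *)
pose e (x y : G) := (x \in X) && adj x y.
pose sigma (a : 'I_k * bool) := (a.1, ~~ a.2).
have sigmaK : involutive sigma by case=> i b; rewrite /sigma /= negbK.
have sigma_neq a : sigma a != a.
  by case: a => i b; rewrite /sigma xpair_eqE /= eqxx; case: b.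
have card_slot : #|{: 'I_k * bool}| = 2 * k.
  by rewrite card_prod card_ord card_bool mulnC.
have [|y|phi [phi_inj phi_conj]] :=
    @slotting_exists _ _ _ e sigma sigmaK sigma_neq (Ordinal k_ge1, true) setT.
- move=> x; have [xX|xX] := boolP (x \in X); last first.
    by rewrite eq_card0 // => y; rewrite !inE /e (negbTE xX).
  rewrite -degX; apply: leq_trans (leq_bigmax_cond _ xX).
  by apply/subset_leq_card/subsetP => y; rewrite !inE => /andP[].
- have [yX|] := boolP (y \in X).
    rewrite eq_card0 // => x; rewrite !inE; apply/andP => -[xX /adjX].
    by rewrite yX xX.
  rewrite -YX => yY; rewrite card_slot -degY.
  apply: leq_trans (leq_bigmax_cond _ yY).
  by apply/subset_leq_card/subsetP => x; rewrite !inE adj_sym => /andP[].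
have {}phi_inj x x' y : x \in X -> x' \in X -> adj x y -> adj x' y ->
    phi x y = phi x' y -> x = x'.
  by move=> xX x'X xy x'y; apply: phi_inj; rewrite ?inE // /e ?xX ?x'X.
have {}phi_conj x y y' : x \in X -> adj x y -> adj x y' -> y != y' ->
    phi x y' = sigma (phi x y).
  by move=> xX xy xy'; apply: phi_conj; rewrite ?inE // /e xX.
(* In each class the slots orient the walks: [x] is entered through its slot
   [true] and left through its slot [false]. *)
pose next x x' := [&& x \in X, x' \in X & [exists y, [&& adj x y, adj x' y,
  ~~ (phi x y).2 & phi x' y == sigma (phi x y)]]].
have slot_inj x y y' : x \in X -> adj x y -> adj x y' ->
    (phi x y).2 = (phi x y').2 -> y = y'.
  move=> xX xy xy' E; apply: contra_eq E => yy'.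
  by rewrite (phi_conj x y y') //=; case: (phi x y).2.
(* Each vertex of [X] has at most one exit and one entry, so [next] is a partial injection. The
   extra links of [f] are harmless: only steps along [next] are used. *)
have [||f f_inj fE] := @partial_injection_extends G next.
- move=> x x' x'' /and3P[xX x'X /existsP[y /and4P[xy x'y nb /eqP E]]].
  case/and3P=> _ x''X /existsP[y' /and4P[xy' x''y' nb' /eqP E']].
  have yy' : y = y' by apply: (slot_inj x); rewrite // (negbTE nb) (negbTE nb').
  by subst y'; apply: (phi_inj _ _ y); rewrite // E E'.
- move=> x x' x'' /and3P[xX x''X /existsP[y /and4P[xy x''y nb /eqP E]]].
  case/and3P=> x'X _ /existsP[y' /and4P[x'y' x''y' nb' /eqP E']].
  have yy' : y = y'.
    by apply: (slot_inj x''); rewrite // E E' /= (negbTE nb) (negbTE nb').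
  by subst y'; apply: (phi_inj _ _ y) => //; apply: (inv_inj sigmaK); rewrite -E.
have [l lP] := step_labelling f_inj.
have next_step x x' : next x x' -> step (l x) (l x').
  move=> nxt; rewrite -(fE _ _ nxt) lP // (fE _ _ nxt).
  apply: contraTneq nxt => ->; apply/and3P => -[_ _ /existsP[y /and4P[_ _ _]]].
  by rewrite eq_sym (negbTE (sigma_neq _)).
(* Two vertices of [X] meeting at [y] in the same class hold its two opposite slots there, hence are
   consecutive. *)
have nextP x x' y : x \in X -> x' \in X -> adj x y -> adj x' y -> x != x' ->
    (phi x y).1 = (phi x' y).1 ->
    phi x' y = sigma (phi x y) /\ (if (phi x y).2 then next x' x else next x x').
  move=> xX x'X xy x'y xx' E1.
  have E : phi x' y = sigma (phi x y).
    have : phi x y != phi x' y.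
      by apply: contraNneq xx' => E; apply/eqP/(phi_inj _ _ y).
    case: (phi x y) (phi x' y) E1 => i b [i' b'] /= <-.
    by rewrite xpair_eqE eqxx /sigma /=; case: b b' => -[].
  split=> //; case: ifP => b; apply/and3P; split=> //; apply/existsP; exists y.
    by rewrite xy x'y E /= b sigmaK eqxx.
  by rewrite xy x'y E b eqxx.
pose kappa x y := let: (i, b) := phi x y in
  (i, if b then in_color (l x) else out_color (l x)).
pose g x y := if x \in X then kappa x y else kappa y x.
have g_sym x y : adj x y -> g x y = g y x.
  by move=> /adjX; rewrite /g => ->; case: (x \in X).
have kappa1 x x' y y' : kappa x y = kappa x' y' -> (phi x y).1 = (phi x' y').1.
  by rewrite /kappa; case: (phi x y) (phi x' y') => [i b] [i' b'] [].
have kappaE x y i b : phi x y = (i, b) ->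
    kappa x y = (i, if b then in_color (l x) else out_color (l x)).
  by rewrite /kappa => ->.
apply: (@star_colorable_of_walks G _ g) => // [x y z yx yz xz|x y z w v].
  have [yX|yX] := boolP (y \in X).
    rewrite /g yX /kappa (phi_conj y x z) //; case: (phi y x) => i b /=.
    rewrite xpair_eqE eqxx; case: b => /=; last rewrite eq_sym.
    - exact: in_out_color.
    - exact: in_out_color.
  have [xX zX] : x \in X /\ z \in X.
    by rewrite (adjX y x) // (adjX y z).
  rewrite adj_sym in yx; rewrite adj_sym in yz.
  (* Equal colours at a vertex of [Y] force one class, hence consecutive vertices of [X], whose out
     and in colours differ. *)
  rewrite /g (negbTE yX); apply/eqP => E.
  have [Ez nxt] := nextP x z y xX zX yx yz xz (kappa1 _ _ _ _ E).
  move: E nxt; rewrite /kappa Ez; case: (phi x y) => i [] /= [E] nxt.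
    by have [/eqP[]] := stepP (next_step _ _ nxt); rewrite -E.
  by have [/eqP[]] := stepP (next_step _ _ nxt).
case/and5P=> xy yz zw wv _ xz yw zv [].
have yX := adjX _ _ xy; have zX := adjX _ _ yz.
have wX := adjX _ _ zw; have vX := adjX _ _ wv.
have [xX|xX] := boolP (x \in X); rewrite xX /= in yX; rewrite yX /= in zX;
  rewrite zX /= in wX; rewrite wX /= in vX; rewrite /g yX zX wX ?xX ?(negbTE xX).
(* Both slots at the middle vertex [x2] lie in one class, and the alternation carries it to the
   outer edges, so [x0], [x2], [x4] are consecutive under [next]. *)
- have forward x0 y1 x2 y3 x4 : x0 \in X -> x2 \in X -> x4 \in X ->
      adj x0 y1 -> adj x2 y1 -> adj x2 y3 -> adj x4 y3 ->
      x0 != x2 -> y1 != y3 -> x2 != x4 -> (phi x2 y1).2 ->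
      kappa x0 y1 = kappa x2 y3 -> kappa x2 y1 <> kappa x4 y3.
    move=> x0X x2X x4X a01 a21 a23 a43 n02 n13 n24 b E1 E2.
    have [i P21] : exists i, phi x2 y1 = (i, true).
      by exists (phi x2 y1).1; case: (phi x2 y1) b => j [].
    have P23 : phi x2 y3 = (i, false) by rewrite (phi_conj x2 y1 y3) ?P21.
    have [P01 nxt02] : phi x0 y1 = (i, false) /\ next x0 x2.
      have [||-> ] := nextP x2 x0 y1 x2X x0X a21 a01; rewrite 1?eq_sym //.
        by rewrite (kappa1 _ _ _ _ E1) P21 P23.
      by rewrite P21.
    have [P43 nxt24] : phi x4 y3 = (i, true) /\ next x2 x4.
      have [||-> ] := nextP x2 x4 y3 x2X x4X a23 a43; rewrite // ?P23 //.
      by rewrite -(kappa1 _ _ _ _ E2) P21.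
    move: E1 E2; rewrite (kappaE _ _ _ _ P01) (kappaE _ _ _ _ P23).
    rewrite (kappaE _ _ _ _ P21) (kappaE _ _ _ _ P43) => -[E1] [E2].
    have [_ _ no] := stepP (next_step _ _ nxt02).
    exact: (no _ (next_step _ _ nxt24)).
  (* A walk against the orientation is reversed, which interchanges the two colour equations. *)
  have [b|b] := boolP (phi z y).2.
    by apply: forward; rewrite // adj_sym.
  move=> E1 E2; apply: (forward v w z y x); rewrite // 1?adj_sym // 1?eq_sym //.
  by rewrite (phi_conj z y w) // adj_sym.
(* The alternation carries the class of [x1] to [x3], so these are consecutive and would have the
   same colour pair. *)
- have forward y0 x1 y2 x3 y4 : x1 \in X -> x3 \in X ->
      adj x1 y0 -> adj x1 y2 -> adj x3 y2 -> adj x3 y4 ->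
      y0 != y2 -> x1 != x3 -> y2 != y4 -> ~~ (phi x1 y2).2 ->
      kappa x1 y0 = kappa x3 y2 -> kappa x1 y2 <> kappa x3 y4.
    move=> x1X x3X a10 a12 a32 a34 n02 n13 n24 b E1 E2.
    have [i P12] : exists i, phi x1 y2 = (i, false).
      by exists (phi x1 y2).1; case: (phi x1 y2) b => j [].
    have P10 : phi x1 y0 = (i, true) by rewrite (phi_conj x1 y2 y0) 1?eq_sym ?P12.
    have [P32 nxt13] : phi x3 y2 = (i, true) /\ next x1 x3.
      have [||-> ] := nextP x1 x3 y2 x1X x3X a12 a32; rewrite // ?P12 //.
      by rewrite -(kappa1 _ _ _ _ E1) P10.
    have P34 : phi x3 y4 = (i, false) by rewrite (phi_conj x3 y2 y4) ?P32.
    move: E1 E2; rewrite (kappaE _ _ _ _ P10) (kappaE _ _ _ _ P32).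
    rewrite (kappaE _ _ _ _ P12) (kappaE _ _ _ _ P34) => -[E1] [E2].
    by have [_ []] := stepP (next_step _ _ nxt13).
  have [b|b] := boolP (phi y z).2; last first.
    by apply: forward; rewrite // adj_sym.
  move=> E1 E2; apply: (forward v w z y x); rewrite // 1?adj_sym // 1?eq_sym //.
  (* The slots at [z] are opposite, so the reversed walk follows the orientation. *)
  have : phi w z = sigma (phi y z).
    have [] := nextP y w z; rewrite // 1?adj_sym //.
    rewrite (phi_conj y x z) -1?(kappa1 _ _ _ _ E1) //; rewrite 1?adj_sym //.
  by move=> ->; rewrite /= b.
Qed.
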